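(* Let $a$ and $b$ be odd nonzero coprime integers. Then the following statements hold: (1) $2\in G_{(T,k)}(a,b)$ for all integers $k\ge 1$ and $0\le T<k$. (2) Let $k,T$ be integers with $0\le T<k$. For every integer $\varepsilon\ge 2$, $2^\varepsilon\in G_{(T,k)}(a,b)$ if and only if $\varepsilon\le \nu_2(a+b)$ and there exists an integer $s\ge 1$ such that $ks+T$ is odd.
   Context: For nonzero coprime integers $a,b$ and integers $0\le T<k$, $G_{(T,k)}(a,b)$ denotes the set of positive integers $d$ such that $d\mid (a^{ks+T}+b^{ks+T})$ for some positive integer $s$. $\nu_2(i)$ is the $2$-adic valuation of a nonzero integer $i$, with the convention $\nu_2(0)=+\infty$. *)

(* Defs.v *)
From mathcomp Require Export all_boot all_order all_algebra.
From mathcomp Require Export classical_sets constructive_ereal.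

Set Implicit Arguments.
Unset Strict Implicit.
Unset Printing Implicit Defensive.

Import Order.TTheory GRing.Theory Num.Theory.
Local Open Scope classical_set_scope.
Local Open Scope ring_scope.

(* G_(T,k)(a,b), the set of d > 0 dividing a^(ks+T) + b^(ks+T) for some s > 0.
   The constraint T < k and those on a and b are left to the statements. *)
Definition Gset (T k : nat) (a b : int) : set nat :=
  [set d : nat | (0 < d)%N /\
     exists s : nat,
       (0 < s)%N /\ (d%:Z %| a ^+ (k * s + T)%N + b ^+ (k * s + T)%N)%Z].

(* The codomain is \bar int rather than nat because logn 2 0 = 0, whereas the
   valuation of 0 has to be +oo. *)
Definition nu2 (i : int) : \bar int :=
  if i == 0 then +oo%E else ((logn 2 `|i|)%:Z)%:E%E.

(* Main.v *)
Require Import Defs.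
From mathcomp Require Import all_boot all_order all_algebra.
From mathcomp Require Import classical_sets constructive_ereal.
From mathcomp Require Import zify ring.

(** Everything depends on the parity of the exponent [n = ks + T].

    If [n] is odd, then [a ^ n + b ^ n = (a + b) * S], where [S] is the
    alternating sum of the [n] products [a ^ (n - 1 - i) * b ^ i]
    ([addrXn_odd]).  When [a] and [b] are odd, [S] is a sum of an odd number of
    odd terms, hence odd, so that [a + b] and [a ^ n + b ^ n] are divisible by
    the same powers of 2 ([dvdz_exp2_addX_odd]).

    If [n] is even, then [a ^ n] and [b ^ n] are squares of odd integers, so
    both are 1 modulo 4 and their sum is 2 modulo 4 ([dvdz4_addX_even]); no
    [2 ^ e] with [e >= 2] can divide it.

    Thus [2 ^ e] with [e >= 2] lies in the set iff some exponent [ks + T] is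
    odd and [2 ^ e] divides [a + b], whereas 2 always lies in it because a sum
    of two odd integers is even. *)

Set Implicit Arguments.
Unset Strict Implicit.
Unset Printing Implicit Defensive.

Import Order.TTheory GRing.Theory Num.Theory.
Local Open Scope ring_scope.

Lemma odd_abszD (x y : int) : odd `|x + y| = odd `|x| (+) odd `|y|.
Proof. lia. Qed.

Lemma odd_abszX (x : int) (n : nat) : odd `|x| -> odd `|x ^+ n|.
Proof. by move=> ox; rewrite abszX oddX ox orbT. Qed.

Lemma odd_absz_sum (n : nat) (F : 'I_n -> int) :
  (forall i, odd `|F i|) -> odd `|\sum_(i < n) F i| = odd n.
Proof.
elim: n F => [|n IHn] F oF; first by rewrite big_ord0.
by rewrite big_ord_recr odd_abszD oF IHn //= addbT.
Qed.

Lemma addrXn_odd (R : comPzRingType) (x y : R) (n : nat) : odd n ->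
  x ^+ n + y ^+ n = (x + y) * \sum_(i < n) x ^+ (n.-1 - i) * (- y) ^+ i.
Proof.
case: n => // n on.
by have := subrXX x (- y) n.+1; rewrite exprNn -signr_odd on expr1 mulN1r !opprK.
Qed.

(** The cofactor of [x + y] in [x ^ n + y ^ n] is odd, hence coprime to
    [2 ^ e], and the equivalence is Gauss's lemma; phrased with divisibility
    instead of valuations, it includes the case [x + y = 0]. *)
Lemma dvdz_exp2_addX_odd (x y : int) (n e : nat) :
    odd `|x| -> odd `|y| -> odd n ->
  ((2 ^ e)%N%:Z %| x ^+ n + y ^+ n)%Z = ((2 ^ e)%N%:Z %| x + y)%Z.
Proof.
move=> ox oy on; rewrite addrXn_odd // Gauss_dvdzl //.
rewrite coprimezE absz_nat coprimeXl // coprime2n odd_absz_sum // => i.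
by rewrite abszM oddM !odd_abszX // abszN.
Qed.

(** Both powers are squares of odd integers, hence 1 modulo 4. *)
Lemma dvdz4_addX_even (x y : int) (n : nat) :
  odd `|x| -> odd `|y| -> ~~ odd n -> ~~ (4 %| x ^+ n + y ^+ n)%Z.
Proof.
move=> ox oy /even_halfK <-; rewrite -muln2 !exprM.
have sq1 (z : int) : odd `|z| -> exists u, z ^+ 2 = 4 * u + 1.
  move=> oz; have [v ->] : exists v, z = 2 * v + 1 by exists (z %/ 2)%Z; lia.
  by exists (v ^+ 2 + v); ring.
have [u ->] := sq1 _ (odd_abszX n./2 ox).
have [v ->] := sq1 _ (odd_abszX n./2 oy).
lia.
Qed.

(** Since every power of 2 divides 0, the value [+oo] at 0 is what makes this
    hold for all [x]. *)
Lemma le_nu2 (e : nat) (x : int) :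
  ((e%:Z)%:E <= nu2 x)%E = ((2 ^ e)%N%:Z %| x)%Z.
Proof.
rewrite /nu2; have [->|x0] := eqVneq x 0; first by rewrite leey dvdz0.
by rewrite lee_fin lez_nat dvdzE absz_nat pfactor_dvdn // absz_gt0.
Qed.

Theorem proposition10 (a b : int) (ha0 : a != 0) (hb0 : b != 0)
    (ha : odd `|a|%N) (hb : odd `|b|%N) (hab : coprimez a b) :
  (forall k T : nat, (1 <= k)%N -> (T < k)%N -> Gset T k a b 2%N) /\
  (forall k T : nat, (T < k)%N ->
     forall e : nat, (2 <= e)%N ->
       (Gset T k a b (2 ^ e)%N <->
        ((e%:Z)%:E <= nu2 (a + b))%E /\
        exists s : nat, (1 <= s)%N /\ odd (k * s + T))).
Proof.
split=> [k T _ _ | k T _ e e2].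
  split=> //; exists 1%N; split=> //.
  by rewrite dvdzE dvdn2 odd_abszD !odd_abszX.
rewrite le_nu2; split=> [[_ [s [s0 dvd_s]]] | [dvd_ab [s [s0 os]]]].
- have os : odd (k * s + T).
    apply: contraT => /(dvdz4_addX_even ha hb) /negP[].
    apply: dvdz_trans dvd_s.
    by rewrite dvdzE !absz_nat (@dvdn_exp2l 2 2).
  by split; [rewrite -(dvdz_exp2_addX_odd e ha hb os) | exists s].
- split; first by rewrite expn_gt0.
  by exists s; split; rewrite // dvdz_exp2_addX_odd.
Qed.
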